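(* Let $\mathcal{C}=(\mathcal{C},\otimes,\mathbf{1}_{\mathcal{C}})$ and $\mathcal{D}=(\mathcal{D},\otimes,\mathbf{1}_{\mathcal{D}})$ be strict monoidal categories. Suppose that the monoid of objects $\mathrm{Ob}(\mathcal{C})$ (under $\otimes$) is a free monoid on symbols $\{X_1,X_2,\ldots,X_p\}$, for some $p\in\mathbb{N}$. Let $(F,J)$ be a (strong) monoidal functor from $\mathcal{C}$ to $\mathcal{D}$, and let $F^{st}$ (on objects) and the isomorphisms $\Psi_X:F^{st}(X)\to F(X)$, $X\in\mathrm{Ob}(\mathcal{C})$, be as defined in the context. Then: (I) The object map $F^{st}$, together with the morphism map given on each morphism $f:X\to Y$ in $\mathcal{C}$ by $F^{st}(f)=\Psi_Y^{-1}\,F(f)\,\Psi_X$, is a strict monoidal functor $F^{st}:\mathcal{C}\to\mathcal{D}$. (II) The morphisms $\Psi_X$ assemble to a natural isomorphism from $F^{st}$ to $F$ (the underlying functor of $(F,J)$).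
   Context: A monoidal functor between strict monoidal categories $\mathcal{C},\mathcal{D}$ is a pair $(F,J)$ where $F:\mathcal{C}\to\mathcal{D}$ is a functor with $F(\mathbf{1}_{\mathcal{C}})\cong\mathbf{1}_{\mathcal{D}}$, and $J$ is a natural isomorphism with components $J_{X,Y}:F(X)\otimes F(Y)\to F(X\otimes Y)$ satisfying $J_{X\otimes Y,Z}(J_{X,Y}\otimes \mathrm{id}_{F(Z)})=J_{X,Y\otimes Z}(\mathrm{id}_{F(X)}\otimes J_{Y,Z})$ for all $X,Y,Z$. Given such $(F,J)$ there is a unique isomorphism $J_0:\mathbf{1}_{\mathcal{D}}\to F(\mathbf{1}_{\mathcal{C}})$ satisfying the usual unit conditions $J_{\mathbf{1},X}(J_0\otimes\mathrm{id}_{F(X)})=\mathrm{id}_{F(X)}=J_{X,\mathbf{1}}(\mathrm{id}_{F(X)}\otimes J_0)$ for all $X$. The monoidal functor is strict if all $J_{X,Y}$ are identities (in particular $F(X\otimes Y)=F(X)\otimes F(Y)$ on objects and on morphisms) and $F(\mathbf{1}_{\mathcal{C}})=\mathbf{1}_{\mathcal{D}}$. Every object of $\mathcal{C}$ is uniquely a word $s=s_1s_2\cdots s_n$ in $\{1,\ldots,p\}$, representing $X_{s_1}\otimes\cdots\otimes X_{s_n}$ (the empty word represents $\mathbf{1}_{\mathcal{C}}$). Define $F^{st}(\mathbf{1}_{\mathcal{C}})=\mathbf{1}_{\mathcal{D}}$ and $F^{st}(X_{s_1}\otimes\cdots\otimes X_{s_n})=F(X_{s_1})\otimes\cdots\otimes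 F(X_{s_n})$. For a word $s$ of length $n\ge 1$ and $1\le j\le n-1$ let $J_j=J_{s_1\cdots s_j,\,s_{j+1}}\otimes\mathrm{id}_{F^{st}(s_{j+2}\cdots s_n)}$, a morphism $F(s_1\cdots s_j)\otimes F^{st}(s_{j+1}\cdots s_n)\to F(s_1\cdots s_{j+1})\otimes F^{st}(s_{j+2}\cdots s_n)$. Define $\Psi_s=J_{n-1}\circ J_{n-2}\circ\cdots\circ J_1:F^{st}(s)\to F(s)$ (the identity if $n=1$), and $\Psi_{\mathbf{1}_{\mathcal{C}}}=J_0$. *)

(* Defs.v *)
From mathcomp Require Import all_boot.
From mathcomp Require Import boolp.

Set Implicit Arguments.
Unset Strict Implicit.
Unset Printing Implicit Defensive.

Declare Scope cat_scope.
Delimit Scope cat_scope with cat.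
Local Open Scope cat_scope.

Reserved Notation "g ∘ f" (at level 40, left associativity).
Reserved Notation "f ≈ g" (at level 70, no associativity).
Reserved Notation "x ⊗ y" (at level 38, left associativity).
Reserved Notation "f ⊗₁ g" (at level 38, left associativity).

Record category := Category {
  ob :> Type;
  hom : ob -> ob -> Type;
  idm : forall x, hom x x;
  comp : forall x y z, hom y z -> hom x y -> hom x z;
  comp1m : forall x y (f : hom x y), comp (idm y) f = f;
  compm1 : forall x y (f : hom x y), comp f (idm x) = f;
  compA : forall x y z t (h : hom z t) (g : hom y z) (f : hom x y),
    comp h (comp g f) = comp (comp h g) f }.

Arguments hom {c} x y.
Arguments idm {c} x.
Arguments comp {c x y z} g f.
Notation "g ∘ f" := (comp g f) : cat_scope.

(* The identity morphism of x, seen as a morphism x -> y when x = y. *)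
Definition eqm (C : category) (x y : C) (e : x = y) : hom x y :=
  match e with erefl => idm x end.

(* Equality of morphisms whose sources and targets are equal objects without
   being convertible; in the presence of uniqueness of identity proofs this is
   Leibniz equality when the two types are the same (heq_eq below). *)
Definition heq (C : category) (x y x' y' : C) (f : hom x y) (g : hom x' y') :=
  exists (p : x = x') (q : y = y'), eqm q ∘ f = g ∘ eqm p.
Notation "f ≈ g" := (heq f g) : cat_scope.

Record iso (C : category) (x y : C) := Iso {
  iso_mor :> hom x y;
  iso_inv : hom y x;
  iso_mK : iso_inv ∘ iso_mor = idm x;
  iso_Km : iso_mor ∘ iso_inv = idm y }.

Record strict_monoidal_category := StrictMonoidalCategory {
  smc_cat :> category;
  tens : smc_cat -> smc_cat -> smc_cat;
  one : smc_cat;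
  tensm : forall x x' y y' : smc_cat,
    hom x x' -> hom y y' -> hom (tens x y) (tens x' y');
  tensA : associative tens;
  tens1x : left_id one tens;
  tensx1 : right_id one tens;
  tensm_id : forall x y, tensm (idm x) (idm y) = idm (tens x y);
  tensm_comp : forall x x' x'' y y' y''
    (f' : hom x' x'') (f : hom x x') (g' : hom y' y'') (g : hom y y'),
    tensm (f' ∘ f) (g' ∘ g) = tensm f' g' ∘ tensm f g;
  tensmA : forall x x' y y' z z'
    (f : hom x x') (g : hom y y') (h : hom z z'),
    tensm f (tensm g h) ≈ tensm (tensm f g) h;
  tens1m : forall x x' (f : hom x x'), tensm (idm one) f ≈ f;
  tensm1 : forall x x' (f : hom x x'), tensm f (idm one) ≈ f }.

Arguments one {s}.
Notation "x ⊗ y" := (tens x y) : cat_scope.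
Notation "f ⊗₁ g" := (tensm f g) : cat_scope.

Definition is_functor (C D : category) (Fo : C -> D)
    (Fm : forall x y : C, hom x y -> hom (Fo x) (Fo y)) : Prop :=
  (forall x, Fm x x (idm x) = idm (Fo x)) /\
  (forall x y z (g : hom y z) (f : hom x y),
     Fm x z (g ∘ f) = Fm y z g ∘ Fm x y f).

Record functor (C D : category) := Functor {
  fob :> C -> D;
  fmap : forall x y : C, hom x y -> hom (fob x) (fob y);
  fmapP : is_functor fmap }.

Arguments fmap {C D} F {x y} f : rename.

Definition natural_iso (C D : category) (F G : functor C D)
    (eta : forall x, iso (F x) (G x)) : Prop :=
  forall x y (f : hom x y), fmap G f ∘ eta x = eta y ∘ fmap F f.

Record monoidal_structure (C D : strict_monoidal_category)
    (F : functor C D) := MonoidalStructure {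
  msJ :> forall x y : C, iso (F x ⊗ F y) (F (x ⊗ y));
  ms_one : inhabited (iso (F one) one);
  msJ_nat : forall x x' y y' (f : hom x x') (g : hom y y'),
    fmap F (f ⊗₁ g) ∘ msJ x y = msJ x' y' ∘ (fmap F f ⊗₁ fmap F g);
  msJ_assoc : forall x y z,
    msJ (x ⊗ y) z ∘ (msJ x y ⊗₁ idm (F z))
      ≈ msJ x (y ⊗ z) ∘ (idm (F x) ⊗₁ msJ y z) }.

Definition is_strict (C D : strict_monoidal_category) (F : functor C D)
    (J : monoidal_structure F) : Prop :=
  (forall x y, J x y ≈ idm (F x ⊗ F y)) /\ F one = one.

Definition unit_conditions (C D : strict_monoidal_category) (F : functor C D)
    (J : monoidal_structure F) (J0 : hom one (F one)) : Prop :=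
  forall x, J one x ∘ (J0 ⊗₁ idm (F x)) ≈ idm (F x) /\
            J x one ∘ (idm (F x) ⊗₁ J0) ≈ idm (F x).

Section Heq.
Variable C : category.
Implicit Types x y z : C.

Lemma eqm_id x (e : x = x) : eqm e = idm x.
Proof. by rewrite (Prop_irrelevance e erefl). Qed.

Lemma heq_eq x y (f g : hom x y) : f ≈ g <-> f = g.
Proof.
split=> [[p [q]]|->]; first by rewrite !eqm_id comp1m compm1.
by exists erefl, erefl; rewrite comp1m compm1.
Qed.

Lemma heq_refl x y (f : hom x y) : f ≈ f.
Proof. exact/heq_eq. Qed.

Lemma heq_sym x y x' y' (f : hom x y) (g : hom x' y') : f ≈ g -> g ≈ f.
Proof.
by move=> fg; case: (fg) => p [q _]; case: _ / p q g fg => q;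
  case: _ / q => g /heq_eq->; apply: heq_refl.
Qed.

Lemma heq_trans x y x' y' x'' y''
    (f : hom x y) (g : hom x' y') (h : hom x'' y'') :
  f ≈ g -> g ≈ h -> f ≈ h.
Proof.
by move=> fg; case: (fg) => p [q _]; case: _ / p q g fg => q;
  case: _ / q => g /heq_eq->.
Qed.

Lemma heq_comp x y z x' y' z' (g : hom y z) (f : hom x y)
    (g' : hom y' z') (f' : hom x' y') :
  g ≈ g' -> f ≈ f' -> g ∘ f ≈ g' ∘ f'.
Proof.
move=> gg ff; case: (gg) (ff) => [p [q _]] [r [_ _]].
case: _ / p q r g' f' gg ff => q; case: _ / q => r; case: _ / r => g' f'.
by move=> /heq_eq-> /heq_eq->; apply: heq_refl.
Qed.

Lemma heq_compI x y z x' y' z' (g : iso y z) (f : hom x y)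
    (g' : iso y' z') (f' : hom x' y') :
  g ≈ g' -> g ∘ f ≈ g' ∘ f' -> f ≈ f'.
Proof.
move=> gg gf; case: (gg) (gf) => [p [q _]] [r [_ _]].
case: _ / p q r g' f' gg gf => q; case: _ / q => r; case: _ / r => g' f'.
move=> /heq_eq gg /heq_eq; rewrite -gg => /(congr1 (comp (iso_inv g))).
by rewrite !compA !iso_mK !comp1m => ->; apply: heq_refl.
Qed.

Lemma heq_id x x' : x = x' -> idm x ≈ idm x'.
Proof. by case: _ /; apply: heq_refl. Qed.

Lemma heq_eqm x y z t (e : x = y) (f : hom y z) (e' : z = t) :
  eqm e' ∘ f ∘ eqm e ≈ f.
Proof.
by case: _ / e f; case: _ / e' => f /=; rewrite comp1m compm1; apply: heq_refl.
Qed.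

Definition iso_comp x y z (g : iso y z) (f : iso x y) : iso x z.
Proof.
exists (g ∘ f) (iso_inv f ∘ iso_inv g).
- by rewrite compA -(compA (iso_inv f)) iso_mK compm1 iso_mK.
- by rewrite compA -(compA g) iso_Km compm1 iso_Km.
Defined.

Definition iso_sym x y (f : iso x y) : iso y x :=
  Iso (iso_Km f) (iso_mK f).

Definition iso_id x : iso x x := Iso (comp1m (idm x)) (comp1m (idm x)).

Definition iso_eq x y (e : x = y) : iso x y :=
  match e with erefl => iso_id x end.

Lemma iso_eqE x y (e : x = y) : iso_eq e ≈ idm x.
Proof. by case: _ / e; apply: heq_refl. Qed.

Lemma iso_comp_eql x y z (e : y = z) (f : iso x y) :
  iso_comp (iso_eq e) f ≈ f.
Proof. by case: _ / e => /=; rewrite comp1m; apply: heq_refl. Qed.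

Lemma iso_comp_eqr x y z (f : iso y z) (e : x = y) :
  iso_comp f (iso_eq e) ≈ f.
Proof. by case: _ / e f => f /=; rewrite compm1; apply: heq_refl. Qed.

End Heq.

Section Tensor.
Variable D : strict_monoidal_category.
Implicit Types x y z : D.

Definition iso_tens x x' y y' (f : iso x x') (g : iso y y') :
  iso (x ⊗ y) (x' ⊗ y').
Proof.
by exists (f ⊗₁ g) (iso_inv f ⊗₁ iso_inv g);
  rewrite -tensm_comp ?iso_mK ?iso_Km tensm_id.
Defined.

Lemma heq_tens x x' y y' a a' b b' (f : @hom D x x') (g : @hom D y y')
    (h : @hom D a a') (k : @hom D b b') :
  f ≈ h -> g ≈ k -> f ⊗₁ g ≈ h ⊗₁ k.
Proof.
move=> fh gk; case: (fh) (gk) => [p [q _]] [r [s _]].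
case: _ / p h fh => h; case: _ / q h => h /heq_eq->.
case: _ / r k gk => k; case: _ / s k => k /heq_eq->.
exact: heq_refl.
Qed.

Lemma tensIl a (u : iso one a) y z (f g : hom y z) :
  idm a ⊗₁ f ≈ idm a ⊗₁ g -> f = g.
Proof.
have conj (h : hom y z) :
    (iso_inv u ⊗₁ idm z) ∘ (idm a ⊗₁ h) ∘ (u ⊗₁ idm y) ≈ h.
  rewrite -!tensm_comp compm1 comp1m compm1 iso_mK; exact: tens1m.
move=> /heq_eq fg; apply/heq_eq/(heq_trans (heq_sym (conj f))).
by rewrite fg; apply: conj.
Qed.

Lemma tensIr a (u : iso one a) y z (f g : hom y z) :
  f ⊗₁ idm a ≈ g ⊗₁ idm a -> f = g.
Proof.
have conj (h : hom y z) :
    (idm z ⊗₁ iso_inv u) ∘ (h ⊗₁ idm a) ∘ (idm y ⊗₁ u) ≈ h.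
  rewrite -!tensm_comp compm1 comp1m compm1 iso_mK; exact: tensm1.
move=> /heq_eq fg; apply/heq_eq/(heq_trans (heq_sym (conj f))).
by rewrite fg; apply: conj.
Qed.

End Tensor.

Section UnitIsomorphism.
Variables (C D : strict_monoidal_category) (F : functor C D).
Variable J : monoidal_structure F.

Let JE x x' y y' : x = x' -> y = y' -> J x y ≈ J x' y'.
Proof. by case: _ /; case: _ /; apply: heq_refl. Qed.

Let JlE x : J one one ⊗₁ idm (F x) ≈ idm (F one) ⊗₁ J one x.
Proof.
by apply: (heq_compI _ (msJ_assoc J one one x)); apply: JE; rewrite tens1x.
Qed.

Let JrE x : J x one ⊗₁ idm (F one) ≈ idm (F x) ⊗₁ J one one.
Proof.
by apply: (heq_compI _ (msJ_assoc J x one one)); apply: JE; rewrite tensx1.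
Qed.

Lemma unit_iso_exists : exists J0 : iso one (F one), unit_conditions J J0.
Proof.
case: (ms_one J) => /iso_sym u; set A := F one.
have e1 : one ⊗ A = F (one ⊗ one) by rewrite !tens1x.
(* g is the inverse of J one one, and h the morphism with h ⊗ id = g. *)
pose g : iso (one ⊗ A) (A ⊗ A) :=
  iso_comp (iso_sym (J one one)) (iso_eq e1).
pose h : iso one A :=
  iso_comp (iso_eq (tensx1 A))
    (iso_comp (iso_comp (iso_comp (iso_tens (iso_id A) (iso_sym u)) g)
                        (iso_tens (iso_id one) u))
              (iso_eq (esym (tensx1 one)))).
have hE : h ⊗₁ idm A ≈ g.
  have : h ⊗₁ idm one ≈ (idm A ⊗₁ iso_inv u) ∘ g ∘ (idm one ⊗₁ u).
    apply: heq_trans (tensm1 _) _.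
    apply: heq_trans (iso_comp_eql _ _) _.
    exact: (iso_comp_eqr (iso_comp (iso_comp _ g) _)).
  move=> /heq_eq hE; suff -> : h ⊗₁ idm A = g by apply: heq_refl.
  have -> : h ⊗₁ idm A = (idm A ⊗₁ u) ∘ (h ⊗₁ idm one) ∘ (idm one ⊗₁ iso_inv u).
    by rewrite -!tensm_comp comp1m !compm1 iso_Km.
  rewrite hE !compA -tensm_comp iso_Km comp1m tensm_id comp1m.
  by rewrite -compA -tensm_comp iso_Km comp1m tensm_id compm1.
have Jh : J one one ∘ (h ⊗₁ idm A) ≈ idm A.
  apply: heq_trans (heq_comp (heq_refl _) (heq_trans hE (iso_comp_eqr _ _))) _.
  by rewrite /= iso_Km; apply: heq_id; rewrite tens1x.
have Jr x : J x one ∘ (idm (F x) ⊗₁ h) ≈ idm (F x).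
  have e : F (x ⊗ one) = F x by rewrite tensx1.
  have e' : F x ⊗ one = F x by rewrite tensx1.
  set k := _ ∘ _.
  have kE := heq_eqm (esym e') k e.
  apply: heq_trans (heq_sym kE) _; apply/heq_eq/(tensIr u).
  apply: heq_trans (heq_tens kE (heq_refl _)) _.
  rewrite -{1}[idm (F one)]comp1m tensm_comp.
  apply: heq_trans (heq_comp (JrE x) (heq_sym (tensmA _ _ _))) _.
  rewrite -tensm_comp comp1m.
  exact: heq_tens (heq_refl _) Jh.
exists h => x; split; last exact: Jr.
have e : F (one ⊗ x) = F x by rewrite tens1x.
have e' : one ⊗ F x = F x by rewrite tens1x.
set k := _ ∘ _.
have kE := heq_eqm (esym e') k e.
apply: heq_trans (heq_sym kE) _; apply/heq_eq/(tensIl u).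
apply: heq_trans (heq_tens (heq_refl _) kE) _.
rewrite -{1}[idm (F one)]comp1m tensm_comp.
apply: heq_trans (heq_comp (heq_sym (JlE x)) (tensmA _ _ _)) _.
rewrite -tensm_comp comp1m; exact: heq_tens (Jr one) (heq_refl _).
Qed.

Lemma unit_iso_unique (J0 J0' : hom one (F one)) :
  unit_conditions J J0 -> unit_conditions J J0' -> J0 = J0'.
Proof.
move=> /(_ one)[J0P _] /(_ one)[J0'P _]; case: (ms_one J) => /iso_sym u.
apply/(tensIr u)/(heq_compI (heq_refl (J one one))).
exact: heq_trans J0P (heq_sym J0'P).
Qed.

Definition unit_iso : iso one (F one) := projT1 (cid unit_iso_exists).

Lemma unit_isoP : unit_conditions J unit_iso.
Proof. exact: projT2 (cid unit_iso_exists). Qed.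

End UnitIsomorphism.

Definition tens_word (C : strict_monoidal_category) (I : Type) (X : I -> C)
    (s : seq I) : C :=
  foldr (fun i x => X i ⊗ x) one s.

(* The object monoid of C is free on the X_i. *)
Definition free_on (C : strict_monoidal_category) (p : nat) (X : 'I_p -> C) :=
  forall x : C, exists! s : seq 'I_p, tens_word X s = x.

Section Strictification.
Variables (C D : strict_monoidal_category) (p : nat) (X : 'I_p -> C).
Hypothesis freeX : free_on X.
Variables (F : functor C D) (J : monoidal_structure F).

Definition word (x : C) : seq 'I_p := projT1 (cid (freeX x)).

Lemma wordK x : tens_word X (word x) = x.
Proof. by case: (projT2 (cid (freeX x))). Qed.

Definition Fst_word (s : seq 'I_p) : D := tens_word (fun i => F (X i)) s.

Definition Fst_ob (x : C) : D := Fst_word (word x).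

(* The morphism J_j, for x = s_1 ... s_j, i = s_{j+1} and t = s_{j+2} ... s_n. *)
Definition Psi_step (x : C) (i : 'I_p) (t : seq 'I_p) :
    iso (F x ⊗ Fst_word (i :: t)) (F (x ⊗ X i) ⊗ Fst_word t) :=
  iso_comp (iso_tens (J x (X i)) (iso_id (Fst_word t)))
           (iso_eq (tensA (F x) (F (X i)) (Fst_word t))).

(* The composite J_{n-1} ... J_j, for x = s_1 ... s_j and t = s_{j+1} ... s_n. *)
Fixpoint Psi_from (x : C) (t : seq 'I_p) :
    iso (F x ⊗ Fst_word t) (F (x ⊗ tens_word X t)) :=
  match t with
  | [::] => iso_eq (etrans (tensx1 (F x)) (esym (congr1 F (tensx1 x))))
  | i :: t' =>
      iso_comp (iso_eq (esym (congr1 F (tensA x (X i) (tens_word X t')))))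
        (iso_comp (Psi_from (x ⊗ X i) t') (Psi_step x i t'))
  end.

Definition Psi_word (s : seq 'I_p) : iso (Fst_word s) (F (tens_word X s)) :=
  match s with
  | [::] => unit_iso J
  | i :: t => Psi_from (X i) t
  end.

Definition Psi (x : C) : iso (Fst_ob x) (F x) :=
  iso_comp (iso_eq (congr1 F (wordK x))) (Psi_word (word x)).

Definition Fst_mor (x y : C) (f : hom x y) : hom (Fst_ob x) (Fst_ob y) :=
  iso_inv (Psi y) ∘ fmap F f ∘ Psi x.

End Strictification.

(* Main.v *)
From Pilot Require (* Restores [compA] and [one], shadowed by MathComp. *)
Import Defs.
From mathcomp Require Import all_boot.
(* Restores [compA] and [one], shadowed by MathComp. *)
Import Defs.

Set Implicit Arguments.
Unset Strict Implicit.
Unset Printing Implicit Defensive.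

(** The isomorphisms [Psi] turn out to be multiplicative,
    [J x y ∘ (Psi x ⊗ Psi y) = Psi (x ⊗ y)]. On words this follows from the
    recursion [Psi (i s) = J (X i) s ∘ (id ⊗ Psi s)] and associativity of [J];
    the recursion itself rebrackets the left-to-right composite defining [Psi],
    again by associativity of [J]. Conjugating [F] by [Psi] then makes [J] an
    identity. *)

Local Open Scope cat_scope.

Section Category.
Variable C : category.

(** Removes a factor that is an identity only up to [≈], such as a cast between equal objects or a
    composite from the unit conditions. *)
Lemma heq_comp_idl (x y z a : C) (g : hom y z) (f : hom x y) :
  g ≈ idm a -> g ∘ f ≈ f.
Proof.
move=> gE; case: (gE) => ya [za _]; move: ya za g f gE => <-; case: _ /.
by move=> g f /heq_eq->; rewrite comp1m; apply: heq_refl.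
Qed.

Lemma heq_comp_idr (x y z a : C) (g : hom y z) (f : hom x y) :
  f ≈ idm a -> g ∘ f ≈ g.
Proof.
move=> fE; case: (fE) => xa [ya _]; move: ya xa g f fE => <-; case: _ /.
by move=> g f /heq_eq->; rewrite compm1; apply: heq_refl.
Qed.

Lemma iso_conjK (a b c d : C) (u : iso a b) (v : iso c d) (f : hom b d) :
  v ∘ (iso_inv v ∘ f ∘ u) = f ∘ u.
Proof. by rewrite !compA iso_Km comp1m. Qed.

Lemma iso_conjM (a b c d k l : C) (u : iso a b) (v : iso c d) (w : iso k l)
    (f : hom b d) (g : hom d l) :
  iso_inv w ∘ (g ∘ f) ∘ u = (iso_inv w ∘ g ∘ v) ∘ (iso_inv v ∘ f ∘ u).
Proof. by rewrite -[RHS]compA -[in RHS]compA iso_conjK !compA. Qed.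

End Category.

Section TensorWord.
Variables (C : strict_monoidal_category) (I : Type) (X : I -> C).

Lemma tens_word_cat (s t : seq I) :
  tens_word X (s ++ t) = tens_word X s ⊗ tens_word X t.
Proof.
by elim: s => [|i s IHs] /=; rewrite ?tens1x // IHs tensA.
Qed.

End TensorWord.

Section MonoidalFunctor.
Variables (C D : strict_monoidal_category) (p : nat) (X : 'I_p -> C).
Hypothesis freeX : free_on X.
Variables (F : functor C D) (J : monoidal_structure F).

Notation T := (tens_word X).
Notation Fw := (Fst_word X F).
Notation P := (Psi_word X J).
Notation Psi := (Psi freeX J).
Notation word := (word freeX).
Notation Fob := (Fst_ob freeX F).
Notation Fmor := (Fst_mor freeX J).

Lemma msJ_heq x x' y y' : x = x' -> y = y' -> J x y ≈ J x' y'.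
Proof. by case: _ /; case: _ /; apply: heq_refl. Qed.

(** By interchange, both sides are associativity of [J] precomposed with the triple tensor of [f],
    [g] and [h]. *)
Lemma msJ_assoc_tens x y z a b c (f : hom a (F x)) (g : hom b (F y))
    (h : hom c (F z)) :
  J (x ⊗ y) z ∘ ((J x y ∘ (f ⊗₁ g)) ⊗₁ h)
    ≈ J x (y ⊗ z) ∘ (f ⊗₁ (J y z ∘ (g ⊗₁ h))).
Proof.
rewrite -{1}[h]comp1m -{2}[f]comp1m !tensm_comp !compA.
apply: heq_comp; first exact: msJ_assoc.
exact/heq_sym/tensmA.
Qed.

(** Induction on [t] for all [x]: the first step [J x (X i)] is absorbed by the hypothesis at
    [x ⊗ X i], and associativity of [J] then moves the brackets to the right. *)
Lemma Psi_fromE x t : Psi_from X J x t ≈ J x (T t) ∘ (idm (F x) ⊗₁ P t).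
Proof.
elim: t x => [|i t IHt] x.
  apply: heq_trans (iso_eqE _) _.
  (* On the empty word [P] is [unit_iso J], so the right unit condition applies. *)
  have [_ /heq_sym] := unit_isoP J x.
  by apply: heq_trans; apply: heq_id; rewrite tensx1.
apply: heq_trans (iso_comp_eql _ _) _.
apply: (@heq_trans _ _ _ _ _ _ _ _
  (Psi_from X J (x ⊗ X i) t ∘ (J x (X i) ⊗₁ idm (Fw t)))).
  exact: heq_comp (heq_refl _) (iso_comp_eqr _ _).
apply: heq_trans (heq_comp (IHt _) (heq_refl _)) _.
rewrite -compA -tensm_comp comp1m compm1.
have := msJ_assoc_tens (idm (F x)) (idm (F (X i))) (P t).
rewrite tensm_id compm1 => h; apply: heq_trans h _.
(* The induction hypothesis serves again, now at [X i], since [P (i :: t)] is by definition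
   [Psi_from X J (X i) t]. *)
apply: heq_comp (heq_refl _) (heq_tens (heq_refl _) _).
exact/heq_sym/IHt.
Qed.

Lemma Psi_word_cons i s :
  P (i :: s) ≈ J (X i) (T s) ∘ (idm (F (X i)) ⊗₁ P s).
Proof. exact: Psi_fromE. Qed.

Lemma Psi_word_cat s t : J (T s) (T t) ∘ (P s ⊗₁ P t) ≈ P (s ++ t).
Proof.
elim: s => [|i s IHs].
  (* Isolating [unit_iso J] in the left factor exposes the left unit condition. *)
  have -> : P [::] ⊗₁ P t
      = (unit_iso J ⊗₁ idm (F (T t))) ∘ (idm one ⊗₁ P t).
    by rewrite -tensm_comp compm1 comp1m.
  rewrite compA; have [h _] := unit_isoP J (T t).
  exact: heq_trans (heq_comp_idl _ h) (tens1m _).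
apply: heq_trans (heq_comp (heq_refl _) (heq_tens (Psi_word_cons i s)
  (heq_refl _))) _.
apply: heq_trans (msJ_assoc_tens _ _ _) _.
apply: heq_trans (heq_sym (Psi_word_cons i (s ++ t))).
apply: heq_comp; last exact: heq_tens (heq_refl _) IHs.
by apply: msJ_heq => //; rewrite tens_word_cat.
Qed.

(** Uniqueness in [free_on] makes [word] inverse to [tens_word X], hence a monoid morphism. *)
Lemma word_unique s x : T s = x -> word x = s.
Proof.
by have [r [_ rU]] := freeX x => sx; rewrite -(rU s sx) (rU _ (wordK freeX x)).
Qed.

Lemma word_one : word one = [::].
Proof. exact: word_unique. Qed.

Lemma word_tens x y : word (x ⊗ y) = word x ++ word y.
Proof. by apply: word_unique; rewrite tens_word_cat !wordK. Qed.

Lemma Fst_ob_one : Fob one = one.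
Proof. by rewrite /Fst_ob word_one. Qed.

Lemma Fst_ob_tens x y : Fob (x ⊗ y) = Fob x ⊗ Fob y.
Proof. by rewrite /Fst_ob word_tens; apply: tens_word_cat. Qed.

Lemma PsiE x : Psi x ≈ P (word x).
Proof. exact: iso_comp_eql. Qed.

Lemma Psi_tens x y : J x y ∘ (Psi x ⊗₁ Psi y) ≈ Psi (x ⊗ y).
Proof.
apply: heq_trans (heq_comp (msJ_heq _ _) (heq_tens (PsiE x) (PsiE y))) _.
- by rewrite wordK.
- by rewrite wordK.
apply: heq_trans (Psi_word_cat _ _) _.
by rewrite -word_tens; apply/heq_sym/PsiE.
Qed.

Lemma Psi_natural x y (f : hom x y) : fmap F f ∘ Psi x = Psi y ∘ Fmor f.
Proof. exact/esym/iso_conjK. Qed.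

Lemma Fst_mor_functor : is_functor Fmor.
Proof.
have [F1 FM] := fmapP F; split=> [x|x y z g f]; rewrite /Fst_mor.
  by rewrite F1 compm1 iso_mK.
by rewrite FM (iso_conjM _ (Psi y)).
Qed.

Lemma Fst_mor_tens x x' y y' (f : hom x x') (g : hom y y') :
  Fmor (f ⊗₁ g) ≈ Fmor f ⊗₁ Fmor g.
Proof.
(* [Q] is [Psi (x' ⊗ y')] in factored form, by [Psi_tens]; cancelling the two on the left leaves an
   equation between composites into [F (x' ⊗ y')]. *)
pose Q := iso_comp (J x' y') (iso_tens (Psi x') (Psi y')).
apply: (@heq_compI _ _ _ _ _ _ _ (Psi (x' ⊗ y')) _ Q).
  exact/heq_sym/Psi_tens.
rewrite -Psi_natural {}/Q; have := Psi_tens x y.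
have := (Psi_natural f, Psi_natural g).
(* Without generalizing, [compA] would unfold [Psi] into its two factors. *)
move: (Psi x) (Psi x') (Psi y) (Psi y') (Psi (x ⊗ y)) => u u' v v' w.
case=> uf vg Jw /=.
(* Naturality of [Psi] in each factor, then naturality of [J]. *)
rewrite -compA -tensm_comp -uf -vg tensm_comp compA -msJ_nat -compA.
exact: heq_comp (heq_refl _) (heq_sym Jw).
Qed.

(** The structure consists of casts along [Fst_ob_tens]. Its naturality is [Fst_mor_tens]; in its
    associativity both sides are identities of equal objects. *)
Lemma Fst_strict :
  exists K : monoidal_structure (Functor Fst_mor_functor), is_strict K.
Proof.
pose K x y : iso (Fob x ⊗ Fob y) (Fob (x ⊗ y)) :=
  iso_eq (esym (Fst_ob_tens x y)).
have K1 x y : K x y ≈ idm (Fob x ⊗ Fob y) by apply: iso_eqE.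
have K1' x y : K x y ≈ idm (Fob (x ⊗ y)).
  by apply: heq_trans (K1 x y) _; apply: heq_id; rewrite Fst_ob_tens.
have Kone : inhabited (iso (Fob one) one).
  by rewrite Fst_ob_one; exists; apply: iso_id.
have Knat x x' y y' (f : @hom C x x') (g : @hom C y y') :
    Fmor (f ⊗₁ g) ∘ K x y = K x' y' ∘ (Fmor f ⊗₁ Fmor g).
  apply/heq_eq; apply: heq_trans (heq_comp_idr _ (K1 x y)) _.
  apply: heq_trans (Fst_mor_tens f g) _.
  exact: heq_sym (heq_comp_idl _ (K1' x' y')).
have KA x y z : K (x ⊗ y) z ∘ (K x y ⊗₁ idm (Fob z))
    ≈ K x (y ⊗ z) ∘ (idm (Fob x) ⊗₁ K y z).
  have KT a b c d (f : @hom D a b) : f ≈ idm d -> f ⊗₁ idm c ≈ idm (d ⊗ c).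
    by move=> h; rewrite -tensm_id; apply: heq_tens h (heq_refl _).
  have TK a b c d (f : @hom D a b) : f ≈ idm d -> idm c ⊗₁ f ≈ idm (c ⊗ d).
    by move=> h; rewrite -tensm_id; apply: heq_tens (heq_refl _) h.
  apply: heq_trans (heq_comp_idr _ (KT _ _ _ _ _ (K1 x y))) _.
  apply: heq_trans (K1' _ _) _.
  apply: heq_sym; apply: heq_trans (heq_comp_idr _ (TK _ _ _ _ _ (K1 y z))) _.
  by apply: heq_trans (K1' _ _) _; rewrite tensA; apply: heq_refl.
exists (@MonoidalStructure _ _ (Functor Fst_mor_functor) K Kone Knat KA).
by split=> [x y|]; [apply: K1 | apply: Fst_ob_one].
Qed.

End MonoidalFunctor.

Theorem theorem2p9 (C D : strict_monoidal_category) (p : nat) (X : 'I_p -> C)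
    (freeX : free_on X) (F : functor C D) (J : monoidal_structure F) :
  exists Fst_functor : is_functor (Fst_mor freeX J),
    let Fst := Functor Fst_functor in
    (exists K : monoidal_structure Fst, is_strict K) /\
    natural_iso (F := Fst) (G := F) (Psi freeX J).
Proof.
exists (Fst_mor_functor freeX J); split; first exact: Fst_strict.
by move=> x y f; apply: Psi_natural.
Qed.
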